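(* Let $D=(V(D),E(D),w)$ be a weighted oriented graph without isolated vertices, in which every source and every sink has weight $1$, and suppose that its underlying graph $G$ is a König graph. Then the edge ideal $I(D)$ is unmixed if and only if $D$ satisfies the following two conditions: (1) $G$ is very well-covered; (2) if $\{b,b'\}$ is in a perfect matching $P$ of $G$ (any perfect matching), $b'\in N_D^+(a)$ and $w(a)>1$, then $N_D(b)\subset N_D^+(a)$. Here $N_D^+(a)$ is the set of out-neighbors of $a$, and $N_D(b)$ is the set of all neighbors of $b$ (the union of its out-neighbors and its in-neighbors).
   Context: All graphs are finite and simple. A weighted oriented graph $D=(V(D),E(D),w)$ with underlying simple graph $G$ consists of $V(D)=V(G)$, a set $E(D)\subset V(D)\times V(D)$ with $E(G)=\{\{x,y\}: (x,y)\in E(D)\}$ and $|E(D)|=|E(G)|$ (each edge of $G$ gets exactly one direction), and a weight function $w:V(D)\to\mathbb{N}_+=\{1,2,\dots\}$. A source is a vertex with only outgoing edges; a sink is a vertex with only incoming edges. For a vertex $x$: the out-neighborhood is $N_D^+(x)=\{y:(x,y)\in E(D)\}$, the in-neighborhood is $N_D^-(x)=\{y:(y,x)\in E(D)\}$, and the neighborhood is their union, $N_D(x)=N_D^+(x)\cup N_D^-(x)$. If $V(D)=\{x_1,\dots,x_n\}$, view the vertices as variables of the polynomial ring $R=K[x_1,\dots,x_n]$, $K$ a field. The edge ideal of $D$ is $I(D)=(x_ix_j^{w(x_j)} : (x_i,x_j)\in E(D))\subset R$. An ideal is unmixed if all its associated primes have the same height. A matching is a set of pairwise disjoint edges; it is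 perfect if it covers all vertices. A vertex cover is a set of vertices meeting every edge. $\nu(G)$ is the maximum cardinality of a matching of $G$, $\tau(G)$ the minimum cardinality of a vertex cover of $G$; $G$ is König if $\tau(G)=\nu(G)$. A stable set is a set of vertices containing no edge; $G$ is well-covered if all its maximal (under inclusion) stable sets have the same cardinality, and very well-covered if it is well-covered, has no isolated vertices and $|V(G)|=2\tau(G)$. *)

(* Defs.v *)
From HB Require Import structures.
From mathcomp Require Import all_boot all_algebra ring_quotient.
From mathcomp Require Import mpoly.

Set Implicit Arguments.
Unset Strict Implicit.
Unset Printing Implicit Defensive.

Import GRing.Theory.

Record sgraph (V : finType) := SGraph {
  adj :> rel V;
  adj_sym : ssrbool.symmetric adj;
  adj_irr : irreflexive adj
}.

Section SimpleGraph.

Variables (V : finType) (G : sgraph V).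

Definition edges : {set {set V}} :=
  [set [set e.1; e.2] | e : V * V in [pred e | G e.1 e.2]].

Definition no_isolated_vertex : Prop := forall x, exists y, G x y.

Definition matching (M : {set {set V}}) : bool :=
  (M \subset edges) && trivIset M.

Definition perfect_matching (M : {set {set V}}) : bool :=
  matching M && (cover M == [set: V]).

Definition vertex_cover (C : {set V}) : bool :=
  [forall e in edges, C :&: e != set0].

Definition matching_number : nat := \max_(M | matching M) #|M|.

(* The default value #|V| is attained by the vertex cover [set: V]. *)
Definition cover_number : nat := \big[minn/#|V|]_(C | vertex_cover C) #|C|.

Definition konig : Prop := cover_number = matching_number.

Definition stable (S : {set V}) : bool :=
  [forall e in edges, ~~ (e \subset S)].

Definition well_covered : Prop :=
  forall S T : {set V}, maxset stable S -> maxset stable T -> #|S| = #|T|.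

Definition very_well_covered : Prop :=
  [/\ well_covered, no_isolated_vertex & #|V| = (2 * cover_number)%N].

End SimpleGraph.

(* [arc_asym] says that no edge gets both directions; for [x = y] it also
   excludes loops. *)
Record wograph (V : finType) := WOGraph {
  arc : rel V;
  arc_asym : forall x y, arc x y -> ~~ arc y x;
  weight : V -> nat;
  weight_gt0 : forall x, 0 < weight x
}.

Section WeightedOrientedGraph.

Variables (V : finType) (D : wograph V).

Lemma underlying_sym : ssrbool.symmetric (fun x y => arc D x y || arc D y x).
Proof. by move=> x y; rewrite orbC. Qed.

Lemma underlying_irr : irreflexive (fun x y => arc D x y || arc D y x).
Proof.
by move=> x; rewrite orbb; apply/negP => Dxx; have := arc_asym Dxx; rewrite Dxx.
Qed.

Definition underlying : sgraph V := SGraph underlying_sym underlying_irr.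

Definition out_nbhd (x : V) : {set V} := [set y | arc D x y].
Definition in_nbhd (x : V) : {set V} := [set y | arc D y x].
Definition nbhd (x : V) : {set V} := out_nbhd x :|: in_nbhd x.

Definition source (x : V) : Prop := in_nbhd x = set0.
Definition sink (x : V) : Prop := out_nbhd x = set0.

End WeightedOrientedGraph.

Local Open Scope ring_scope.

Section Ideals.

Variable R : comNzRingType.

Definition generated_ideal (I : finType) (A : pred I) (F : I -> R) (p : R) :
  Prop := exists c : I -> R, p = \sum_(i | A i) c i * F i.

(* [idealr_closed] includes properness. *)
Definition prime_ideal (P : {pred R}) : Prop :=
  idealr_closed P /\ prime_idealr_closed P.

(* [P] is a prime of the form [I : f]. *)
Definition associated_prime (I : R -> Prop) (P : {pred R}) : Prop :=
  prime_ideal P /\ exists f : R, forall g : R, g \in P <-> I (g * f).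

(* There is a strictly increasing chain [Q 0 < Q 1 < ... < Q h = P] of prime
   ideals; the values [Q i] with [h < i] are irrelevant. *)
Definition has_prime_chain (P : {pred R}) (h : nat) : Prop :=
  exists Q : nat -> {pred R},
    [/\ forall i, (i <= h)%N -> prime_ideal (Q i),
        forall i, (i < h)%N ->
          {subset Q i <= Q i.+1} /\ ~ {subset Q i.+1 <= Q i}
      & Q h =i P].

Definition has_height (P : {pred R}) (h : nat) : Prop :=
  has_prime_chain P h /\ forall k, has_prime_chain P k -> (k <= h)%N.

(* A prime of infinite height has no [h] with [has_height P h]; since [P] and
   [Q] are exchangeable, this is equality of heights in all cases. *)
Definition unmixed (I : R -> Prop) : Prop :=
  forall P Q : {pred R}, associated_prime I P -> associated_prime I Q ->
  forall h : nat, has_height P h -> has_height Q h.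

End Ideals.

Section EdgeIdeal.

Variables (K : fieldType) (V : finType) (D : wograph V).

Definition vertex_var (x : V) : {mpoly K[#|V|]} := 'X_(enum_rank x).

Definition edge_ideal : {mpoly K[#|V|]} -> Prop :=
  generated_ideal (fun e : V * V => arc D e.1 e.2)
    (fun e => vertex_var e.1 * vertex_var e.2 ^+ weight D e.2).

End EdgeIdeal.

Arguments edge_ideal K {V} D _.

(* Main.v *)
Require Import Defs.
From mathcomp Require Import all_boot all_algebra.
From mathcomp Require Import mpoly.
From mathcomp Require Import ring_quotient zify.

Set Implicit Arguments.
Unset Strict Implicit.
Unset Printing Implicit Defensive.

Import GRing.Theory.

(* The associated primes of I(D) are generated by sets of variables, and such a
   prime has the cardinality of the set as its height, because chains of primes
   in K[x_1, ..., x_n] have length at most n: picking one element in each step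
   of a chain gives elements without any nontrivial algebraic relation, whereas
   any n + 1 polynomials satisfy one, by counting monomials.

   If I(D) is unmixed, all strong vertex covers have the same cardinality, since
   each of them generates an associated prime.  Minimal covers are strong, so G
   is well-covered, and the König property makes it very well-covered.  When
   w(a) > 1, the vertex a is not a source; for any c -> a, extending {c} to a
   maximal stable set S avoiding a and its out-neighbours yields a strong cover,
   hence S meets every edge of a perfect matching.  Applied to {b, b'}, this
   gives condition (2).

   Conversely, assume (1) and (2) and let m be a monomial outside I(D).  Let H
   be the set of vertices x with m_x >= w(x), and B the set of out-neighbours
   of those x with 0 < m_x < w(x).  By (2), H together with the matching
   partners of B is stable, and a maximal stable set S containing it misses B.
   Then m lies outside the primary component of the minimal cover V \ S.  So
   I(D) is the intersection of the components of its minimal covers, all of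
   which have the same cardinality. *)

(** * Stable sets, vertex covers and matchings *)

Section SimpleGraphTheory.

Variables (V : finType) (G : sgraph V).

Lemma mem_edges (x y : V) : G x y -> [set x; y] \in edges G.
Proof. by move=> Gxy; apply/imsetP; exists (x, y). Qed.

Lemma edgesE (e : {set V}) :
  e \in edges G -> exists x y, G x y /\ e = [set x; y].
Proof. by case/imsetP=> -[x y] Gxy ->; exists x, y. Qed.

Lemma edge_card (e : {set V}) : e \in edges G -> #|e| = 2.
Proof.
case/edgesE=> x [y [Gxy ->]]; rewrite cards2; case: eqP Gxy => // ->.
by rewrite adj_irr.
Qed.

Lemma edges_adj (x y : V) : [set x; y] \in edges G -> G x y.
Proof.
move=> exy; have := edge_card exy; rewrite cards2; case: (eqVneq x y) => // nxy _.
case/edgesE: exy => u [v [Guv Euv]].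
have : x \in [set u; v] by rewrite -Euv !inE eqxx.
have : y \in [set u; v] by rewrite -Euv !inE eqxx orbT.
rewrite !inE => /orP[]/eqP Ey /orP[]/eqP Ex; move: nxy; subst => //.
- by rewrite eqxx.
- by rewrite adj_sym.
- by rewrite eqxx.
Qed.

Lemma stableP (S : {set V}) :
  reflect (forall x y, x \in S -> y \in S -> ~~ G x y) (stable G S).
Proof.
apply: (iffP forall_inP) => [stS x y Sx Sy | stS e /edgesE[x [y [Gxy ->]]]].
  by apply/negP=> /mem_edges/stS; rewrite subUset !sub1set Sx Sy.
by rewrite subUset !sub1set; apply: contraTN Gxy => /andP[]; apply: stS.
Qed.

Lemma vertex_cover_stable (C : {set V}) : vertex_cover G C = stable G (~: C).
Proof.
apply: eq_forallb => e; congr (_ ==> _); congr (~~ _).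
by rewrite setI_eq0 disjoint_sym disjoints_subset.
Qed.

Lemma vertex_coverP (C : {set V}) :
  reflect (forall x y, G x y -> x \notin C -> y \in C) (vertex_cover G C).
Proof.
rewrite vertex_cover_stable; apply: (iffP (stableP _)) => covC x y.
  by move=> Gxy nCx; apply: contraLR Gxy => nCy; apply: covC; rewrite inE.
by rewrite !inE => nCx nCy; apply: contraNN nCy => /covC; apply.
Qed.

Lemma maxset_stable_adj (S : {set V}) (x : V) :
  maxset (stable G) S -> x \notin S -> exists2 y, y \in S & G x y.
Proof.
case/maxsetP=> /stableP stS maxS nSx; apply/exists_inP.
apply: contraNT nSx => /exists_inPn nG.
suff <- : x |: S = S by rewrite setU11.
apply: maxS (subsetUr _ _); apply/stableP=> y z.
rewrite !inE => /predU1P[->|Sy] /predU1P[->|Sz].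
- by rewrite adj_irr.
- exact: nG.
- by rewrite adj_sym; apply: nG.
- exact: stS.
Qed.

Lemma cover_number_le (C : {set V}) :
  vertex_cover G C -> cover_number G <= #|C|.
Proof.
rewrite /cover_number => covC; rewrite -big_filter.
have : C \in [seq C <- index_enum {set V} | vertex_cover G C].
  by rewrite mem_filter covC mem_index_enum.
elim: [seq _ <- _ | _] => //= A s IHs; rewrite inE big_cons.
by case/predU1P=> [<-|/IHs]; rewrite geq_min ?leqnn // => ->; rewrite orbT.
Qed.

Lemma cover_number_le_card : cover_number G <= #|V|.
Proof.
by rewrite -cardsT cover_number_le //; apply/vertex_coverP=> *; rewrite inE.
Qed.

Lemma cover_numberP :
  exists2 C : {set V}, vertex_cover G C & #|C| = cover_number G.
Proof.
apply: (big_rec (fun k => exists2 C : {set V}, vertex_cover G C & #|C| = k)).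
  by exists setT; rewrite ?cardsT //; apply/vertex_coverP => *; rewrite inE.
move=> C k covC [B covB <-]; rewrite /minn; case: ltnP => _.
  by exists C.
by exists B.
Qed.

(** A stable set properly containing [~: C] would have a smaller cover as its complement. *)
Lemma minimum_cover_maxset (C : {set V}) :
  vertex_cover G C -> #|C| = cover_number G -> maxset (stable G) (~: C).
Proof.
move=> covC minC; apply/maxsetP; split=> [|S stS subS].
  by rewrite -vertex_cover_stable.
apply/eqP; rewrite eq_sym eqEcard subS /=.
have /cover_number_le: vertex_cover G (~: S) by rewrite vertex_cover_stable setCK.
by rewrite -minC [#|C|]cardsCs [#|~: S|]cardsCs setCK leq_sub2lE ?max_card.
Qed.

Lemma matching_numberP :
  exists2 M : {set {set V}}, matching G M & #|M| = matching_number G.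
Proof.
have m0 : matching G set0.
  by rewrite /matching sub0set; apply/trivIsetP=> A B; rewrite inE.
rewrite /matching_number (bigop.bigmax_eq_arg set0) //.
by case: arg_maxnP => // M mM _; exists M.
Qed.

(** Every edge of [M] contains at most one vertex of [S]. *)
Lemma stable_matching_card (M : {set {set V}}) (S : {set V}) :
  matching G M -> stable G S -> #|S :&: cover M| <= #|M|.
Proof.
move=> /andP[/subsetP subM tM] /stableP stS.
have -> : #|S :&: cover M| = \sum_(x in cover M) (x \in S).
  rewrite -sum1_card big_mkcond /= [RHS]big_mkcond /=; apply: eq_bigr => x _.
  by rewrite inE andbC; case: (x \in cover M); case: (x \in S).
rewrite big_trivIset //= -sum1_card leq_sum // => e /subM eE.
case/edgesE: (eE) => x [y [Gxy ->]].
have nxy : x != y by apply: contraTneq Gxy => ->; rewrite adj_irr.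
rewrite big_setU1 ?inE //= big_set1.
case: (boolP (x \in S)) => Sx; case: (boolP (y \in S)) => Sy //.
by have := stS _ _ Sx Sy; rewrite Gxy.
Qed.

(** Since [S] misses [e], the matching [M :\ e] still covers all of [S :&: cover M]. *)
Lemma stable_matching_card_lt (M : {set {set V}}) (S e : {set V}) :
  matching G M -> stable G S -> e \in M -> [disjoint S & e] ->
  #|S :&: cover M| < #|M|.
Proof.
move=> mM stS Me dSe; rewrite (cardsD1 e) Me add1n ltnS.
have mMe : matching G (M :\ e).
  case/andP: mM => subM tM; rewrite /matching (subset_trans (subD1set _ _) subM).
  exact: trivIsetS (subD1set _ _) tM.
apply: leq_trans (stable_matching_card mMe stS); apply: subset_leq_card.
apply/subsetP=> x; rewrite !inE => /andP[Sx /bigcupP[A MA Ax]]; rewrite Sx /=.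
apply/bigcupP; exists A => //; rewrite !inE MA andbT.
by apply: contraTneq Ax => ->; rewrite (disjointFr dSe).
Qed.

Lemma matching_cover_card (M : {set {set V}}) :
  matching G M -> #|cover M| = (2 * #|M|)%N.
Proof.
case/andP=> /subsetP subM /eqP <-.
rewrite mulnC -sum_nat_const; apply: eq_bigr => e /subM; exact: edge_card.
Qed.

Lemma well_covered_card (S : {set V}) :
  well_covered G -> maxset (stable G) S -> (#|S| = #|V| - cover_number G)%N.
Proof.
move=> wcG maxS; have [C covC minC] := cover_numberP.
rewrite (wcG _ _ maxS (minimum_cover_maxset covC minC)) -minC.
by rewrite [#|~: C|]cardsCs setCK.
Qed.

Lemma extend_stable (S : {set V}) :
  stable G S -> exists2 T : {set V}, maxset (stable G) T & S \subset T.
Proof. by move=> stS; have [T] := maxset_exists stS; exists T. Qed.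

(* A maximum matching of a König graph has [cover_number] edges.  A vertex it
   misses could be avoided by a maximal stable set through one of its
   neighbours, which would then be too small. *)
Lemma konig_perfect_matching :
  konig G -> no_isolated_vertex G -> well_covered G ->
  exists2 M, perfect_matching G M & #|M| = cover_number G.
Proof.
move=> kG niG wcG; have [M mM cM] := matching_numberP.
exists M; last by rewrite cM kG.
rewrite /perfect_matching mM /=; apply: contraT => ncM.
have /subsetPn[s _ nMs] : ~~ ([set: V] \subset cover M).
  by apply: contraNN ncM; rewrite eqEsubset subsetT.
have [c Gsc] := niG s.
have stc : stable G [set c].
  by apply/stableP=> x y /set1P-> /set1P->; rewrite adj_irr.
have [T maxT /subsetP/(_ c (set11 c)) Tc] := extend_stable stc.
have stT := maxsetp maxT; have := stable_matching_card mM stT.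
have nTs : s \notin T.
  by apply: contraTN Gsc => Ts; move/stableP: stT; apply.
have cT := well_covered_card wcG maxT.
(* As [T] has at most [#|M|] vertices in [cover M], this strict bound forces [#|T| < #|V| - #|M|],
   against [cT]. *)
have : #|T :\: cover M| < #|~: cover M|.
  apply: proper_card; rewrite properE setDE subsetIr /=.
  by apply/subsetPn; exists s; rewrite ?in_setC // in_setI (negbTE nTs).
have := matching_cover_card mM; have := cardsID (cover M) T.
have := cardsC (cover M); have := cover_number_le_card; rewrite cM -kG cT; lia.
Qed.

Lemma perfect_matching_adj (M : {set {set V}}) (x y : V) :
  perfect_matching G M -> [set x; y] \in M -> G x y.
Proof. by case/andP=> /andP[/subsetP subM _] _ /subM/edges_adj. Qed.

Lemma perfect_matching_edge (M : {set {set V}}) (x : V) :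
  perfect_matching G M -> exists y, [set x; y] \in M.
Proof.
case/andP=> /andP[/subsetP subM _] /eqP covM.
have /bigcupP[e Me xe] : x \in cover M by rewrite covM.
case/edgesE: (subM e Me) => u [v [_ Ee]]; move: xe; rewrite Ee.
case/set2P=> ->; first by exists v; rewrite -Ee.
by exists u; rewrite setUC -Ee.
Qed.

Lemma konig_very_well_covered :
  konig G -> no_isolated_vertex G -> well_covered G -> very_well_covered G.
Proof.
move=> kG niG wcG; split=> //.
have [M /andP[mM /eqP covM] <-] := konig_perfect_matching kG niG wcG.
by rewrite -(matching_cover_card mM) covM cardsT.
Qed.

(** Since [#|V|] is twice the cover number, [M] has exactly [#|S|] edges, so [S] must use each of
    them. *)
Lemma very_well_covered_stable_matching (M : {set {set V}}) (S : {set V})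
    (b b' : V) :
  very_well_covered G -> perfect_matching G M -> stable G S ->
  #|S| = cover_number G -> [set b; b'] \in M -> (b \in S) || (b' \in S).
Proof.
case=> _ _ cV /andP[mM /eqP covM] stS cS Mbb'; apply: contraT => /norP[nSb nSb'].
have := stable_matching_card_lt mM stS Mbb'; rewrite covM setIT cS.
have : [disjoint S & [set b; b']].
  rewrite disjoint_sym disjoints_subset; apply/subsetP=> x.
  by rewrite !inE => /orP[]/eqP->.
move=> -> /(_ isT); have := matching_cover_card mM; rewrite covM cardsT cV.
lia.
Qed.

End SimpleGraphTheory.

(** * Strong vertex covers and the combinatorics of both implications *)

Section StrongCovers.

Variables (V : finType) (D : wograph V).
Local Notation arc := Defs.arc.
Implicit Types (C S : {set V}) (a b c x y z : V).

Let G := underlying D.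

Lemma underlyingE x y : G x y = arc D x y || arc D y x.
Proof. by []. Qed.

Lemma arc_neq x y : arc D x y -> x != y.
Proof.
by move=> Dxy; apply: contraTneq Dxy => ->; apply/negP=> /[dup]/arc_asym/negP.
Qed.

Lemma mem_nbhd x y : (y \in nbhd D x) = G x y.
Proof. by rewrite !inE. Qed.

(* Equivalent to the usual definition of strong vertex covers through the
   partition [L1, L2, L3]: a vertex of [C] without neighbour outside [C] needs
   an in-neighbour in [C] of weight at least 2 which is not in [L1]. *)
Definition strong_cover C : Prop :=
  vertex_cover G C /\
  forall y, y \in C ->
    (exists2 z, z \notin C & G y z) \/
    (exists z, [/\ arc D z y, 1 < weight D z & out_nbhd D z \subset C]).

Lemma maxset_stable_strong S : maxset (stable G) S -> strong_cover (~: S).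
Proof.
move=> maxS; split; first by rewrite vertex_cover_stable setCK (maxsetp maxS).
move=> y; rewrite inE => /(maxset_stable_adj maxS)[z Sz Gyz].
by left; exists z; rewrite // inE Sz.
Qed.

(* [S] is maximal among the stable sets avoiding [a] and its out-neighbours. *)
Lemma strong_cover_in_nbr a c :
  1 < weight D a -> arc D c a ->
  exists S, [/\ stable G S, c \in S, a \notin S,
                [disjoint S & out_nbhd D a] & strong_cover (~: S)].
Proof.
move=> wa Dca; pose Q S := stable G S && [disjoint S & a |: out_nbhd D a].
have Qc : Q [set c].
  apply/andP; split.
    by apply/stableP=> x y /set1P-> /set1P->; rewrite adj_irr.
  by rewrite disjoints1 !inE negb_or (arc_asym Dca) andbT arc_neq.
have [S /maxsetP[/andP[stS dS] maxS]] := maxset_exists Qc; rewrite sub1set => Sc.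
have nSN x : x \in a |: out_nbhd D a -> x \notin S.
  by move=> Nx; apply: contraTN Nx => Sx; rewrite (disjointFr dS).
exists S; split=> //.
- by rewrite nSN // setU11.
- by apply: disjointWr dS; rewrite subsetUr.
split=> [|y]; first by rewrite vertex_cover_stable setCK.
(* For an out-neighbour of [a] the second alternative holds through [a]; [a] itself has the
   neighbour [c] in [S]; any other vertex has one by maximality. *)
rewrite inE => nSy; have [Nay|] := boolP (y \in out_nbhd D a).
  right; exists a; split=> //; first by rewrite inE in Nay.
  by apply/subsetP=> x Nax; rewrite inE nSN // setU1r.
have [->|nya nNay] := eqVneq y a.
  by move=> _; left; exists c; rewrite ?inE ?Sc // underlyingE Dca orbT.
left; suff /exists_inP[z Sz Gyz] : [exists z in S, G y z].
  by exists z; rewrite // inE Sz.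
apply: contraNT nSy => /exists_inPn nG.
suff <- : y |: S = S by rewrite setU11.
apply: maxS (subsetUr _ _); apply/andP; split; last first.
  rewrite disjoints_subset subUset sub1set -disjoints_subset dS andbT.
  by rewrite in_setC in_setU1 negb_or nya.
apply/stableP=> u v; rewrite !inE => /predU1P[->|Su] /predU1P[->|Sv].
- by rewrite adj_irr.
- exact: nG.
- by rewrite adj_sym; apply: nG.
- by move/stableP: stS; apply.
Qed.

Lemma strong_covers_equicardinal :
  no_isolated_vertex G -> (forall x, source D x -> weight D x = 1) -> konig G ->
  (forall C C', strong_cover C -> strong_cover C' -> #|C| = #|C'|) ->
  very_well_covered G /\
  (forall (P : {set {set V}}) a b b',
     perfect_matching G P -> [set b; b'] \in P ->
     b' \in out_nbhd D a -> 1 < weight D a -> nbhd D b \subset out_nbhd D a).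
Proof.
move=> niG wsrc kG eqC.
have wcG : well_covered G.
  move=> S T maxS maxT.
  have /maxset_stable_strong scS := maxS; have /maxset_stable_strong scT := maxT.
  by rewrite cardsCs (eqC _ _ scS scT) -cardsCs.
have vwcG := konig_very_well_covered kG niG wcG.
split=> // P a b b' pmP Pbb' Nab' wa.
have Dab' : arc D a b' by rewrite inE in Nab'.
have Gbb' := perfect_matching_adj pmP Pbb'.
have [C covC minC] := cover_numberP G.
have maxC := minimum_cover_maxset covC minC.
(* All strong covers have [cover_number G] vertices, hence so does [S]. *)
have strong_meets S : stable G S -> strong_cover (~: S) -> (b \in S) || (b' \in S).
  move=> stS scS; apply: (very_well_covered_stable_matching vwcG pmP) => //.
  have := eqC _ _ scS (maxset_stable_strong maxC).
  rewrite setCK minC; case: vwcG => _ _; have := cardsC S; lia.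
(* A maximal stable set containing [S] could contain neither [b] nor [b']. *)
have max_meets S x y : stable G S -> x \in S -> G b x -> y \in S -> G b' y -> False.
  move=> stS Sx Gbx Sy Gb'y; have [T maxT /subsetP subT] := extend_stable stS.
  have stT := maxsetp maxT.
  have := strong_meets _ stT (maxset_stable_strong maxT).
  move/stableP: stT => stT; case/orP=> [Tb|Tb'].
    by have := stT _ _ Tb (subT _ Sx); rewrite Gbx.
  by have := stT _ _ Tb' (subT _ Sy); rewrite Gb'y.
have Gb'a : G b' a by rewrite underlyingE Dab' orbT.
(* The stable set through [c] avoids [a] and [b'], so it contains [b] as well. *)
have in_nbr c : arc D c a -> a != b /\ ~~ G b c.
  move=> Dca; have [S [stS Sc nSa dS scS]] := strong_cover_in_nbr wa Dca.
  have Sb : b \in S.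
    by have := strong_meets S stS scS; rewrite (disjointFl dS Nab') orbF.
  split; first by apply: contraNneq nSa => ->.
  by move/stableP: stS; apply.
have nab : a != b.
  (* [a] is not a source, because its weight exceeds 1. *)
  have /set0Pn[d] : in_nbhd D a != set0.
    by apply/eqP=> /wsrc wa1; rewrite wa1 in wa.
  by rewrite inE => /in_nbr[].
apply/subsetP=> c; rewrite mem_nbhd inE => Gbc.
have [Gac|nGac] := boolP (G a c).
  by move: Gac; rewrite underlyingE => /orP[//|/in_nbr[_]]; rewrite Gbc.
(* If not adjacent, [a] and [c] form a stable set with a neighbour of [b'] and one of [b]. *)
case: (@max_meets [set a; c] c a); rewrite ?set21 ?set22 //.
apply/stableP=> x y /set2P[]-> /set2P[]->; rewrite ?adj_irr //.
by rewrite adj_sym.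
Qed.

(* With [m] the exponent vector of a monomial outside the edge ideal, the
   complement of [S] is a minimal cover whose primary component misses it. *)
Lemma maxset_stable_avoiding (m : V -> nat) :
  no_isolated_vertex G -> konig G -> very_well_covered G ->
  (forall (P : {set {set V}}) a b b',
     perfect_matching G P -> [set b; b'] \in P ->
     b' \in out_nbhd D a -> 1 < weight D a -> nbhd D b \subset out_nbhd D a) ->
  (forall x y, arc D x y -> 0 < m x -> m y < weight D y) ->
  exists2 S, maxset (stable G) S &
    forall x, x \notin S -> m x < weight D x /\
      (0 < m x -> [disjoint out_nbhd D x & S]).
Proof.
move=> niG kG [wcG _ _] nbP mP.
have [P pmP _] := konig_perfect_matching kG niG wcG.
pose H := [set x | weight D x <= m x].
(* These vertices have weight above 1, so condition (2) applies to them; [nbB] is that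
   application. *)
pose M x := 0 < m x < weight D x.
have Mw x : M x -> 1 < weight D x by rewrite /M; lia.
pose B := [set y | [exists x, M x && arc D x y]].
pose PB := [set b | [exists b', (b' \in B) && ([set b; b'] \in P)]].
have nbB b b' x :
    [set b; b'] \in P -> M x -> arc D x b' -> forall y, G b y -> arc D x y.
  move=> Pbb' /Mw wx Dxb' y Gby.
  have Nxb' : b' \in out_nbhd D x by rewrite inE.
  have /subsetP/(_ y) := nbP _ _ _ _ pmP Pbb' Nxb' wx.
  by rewrite mem_nbhd inE; apply.
have nHB x : x \in B -> x \notin H.
  rewrite !inE -ltnNge => /existsP[y /andP[/andP[my _] Dyx]]; exact: mP Dyx my.
have stH x y : x \in H -> y \in H -> ~~ arc D x y.
  rewrite !inE => Hx; rewrite leqNgt; apply: contraNN => Dxy.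
  by apply: mP Dxy _; apply: leq_trans Hx; apply: weight_gt0.
have PBH x y : x \in PB -> y \in H -> ~~ G x y.
  rewrite inE => /existsP[x' /andP[]].
  rewrite inE => /existsP[z /andP[Mz Dzx']] Pxx'.
  apply: contraTN => Gxy; apply: nHB; rewrite inE; apply/existsP; exists z.
  by rewrite Mz (nbB _ _ _ Pxx' Mz Dzx').
have stS0 : stable G (H :|: PB).
  apply/stableP=> x y; rewrite !in_setU => /orP[Hx|PBx] /orP[Hy|PBy].
  - by rewrite underlyingE negb_or !stH.
  - by rewrite adj_sym PBH.
  - exact: PBH.
  move: PBx PBy; rewrite !inE.
  case/existsP=> x' /andP[]; rewrite inE => /existsP[u /andP[Mu Dux']] Pxx'.
  case/existsP=> y' /andP[]; rewrite inE => /existsP[v /andP[Mv Dvy']] Pyy'.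
  apply/negP=> Gxy; have Gyx : G y x by rewrite adj_sym.
  (* Condition (2) first yields arcs from [u] to [y] and from [v] to [x]; applied again with the
     ends of the matching edges swapped, it yields arcs between [u] and [v] both ways. *)
  have Duy := nbB _ _ _ Pxx' Mu Dux' _ Gxy.
  have Dvx := nbB _ _ _ Pyy' Mv Dvy' _ Gyx.
  have Py'y : [set y'; y] \in P by rewrite setUC.
  have Px'x : [set x'; x] \in P by rewrite setUC.
  have Duv : arc D u v.
    by apply: (nbB _ _ _ Py'y Mu Duy); rewrite underlyingE Dvy' orbT.
  have /negP[] := arc_asym Duv.
  by apply: (nbB _ _ _ Px'x Mv Dvx); rewrite underlyingE Dux' orbT.
have [S maxS /subsetP subS] := extend_stable stS0; exists S => // x nSx.
have nHx : x \notin H by apply: contraNN nSx => Hx; apply: subS; rewrite inE Hx.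
have mx : m x < weight D x by move: nHx; rewrite inE -ltnNge.
split=> // m0; rewrite disjoints_subset; apply/subsetP=> y; rewrite !inE => Dxy.
have [z Pyz] := perfect_matching_edge y pmP.
have Sz : z \in S.
  (* [y] is in [B], so its matching partner [z] is in [PB]. *)
  apply: subS; rewrite inE; apply/orP; right; rewrite inE; apply/existsP; exists y.
  rewrite setUC Pyz andbT inE; apply/existsP; exists x; by rewrite /M m0 mx Dxy.
apply: contraTN (perfect_matching_adj pmP Pyz) => Sy.
by have /maxsetp/stableP := maxS; apply.
Qed.

End StrongCovers.

(** * Closure properties of prime ideals *)

Section PrimeIdeals.
Local Open Scope ring_scope.
Variable R : comNzRingType.
Implicit Types (P Q : {pred R}) (x y : R).

Lemma prime_ideal0 P : prime_ideal P -> 0 \in P.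
Proof. by case=> -[]. Qed.

Lemma prime_ideal1 P : prime_ideal P -> 1 \notin P.
Proof. by case=> -[]. Qed.

Lemma prime_idealD P x y : prime_ideal P -> x \in P -> y \in P -> x + y \in P.
Proof. by case=> -[_ _ lP] _ Px Py; rewrite -[x]mul1r lP. Qed.

Lemma prime_idealMl P x y : prime_ideal P -> y \in P -> x * y \in P.
Proof. by case=> -[P0 _ lP] _ Py; rewrite -[_ * _]addr0 lP. Qed.

Lemma prime_idealMr P x y : prime_ideal P -> x \in P -> x * y \in P.
Proof. by move=> pP Px; rewrite mulrC prime_idealMl. Qed.

Lemma prime_idealDr P x y :
  prime_ideal P -> y \in P -> x + y \in P -> x \in P.
Proof.
move=> pP Py Pxy; rewrite -[x](addrK y) -mulN1r addrC.
by case: pP => -[_ _ lP] _; apply: lP.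
Qed.

Lemma prime_idealM P x y :
  prime_ideal P -> x * y \in P -> x \notin P -> y \in P.
Proof. by case=> _ /(_ x y) pP /pP/orP[->|]. Qed.

Lemma prime_idealX P x k : prime_ideal P -> x \notin P -> x ^+ k \notin P.
Proof.
move=> pP nPx; elim: k => [|k IHk]; first exact: prime_ideal1.
by rewrite exprS; apply: contraNN IHk => /prime_idealM; apply.
Qed.

Lemma prime_ideal_prod P (I : Type) (r : seq I) (A : pred I) (F : I -> R) :
  prime_ideal P -> (forall i, A i -> F i \notin P) ->
  \prod_(i <- r | A i) F i \notin P.
Proof.
move=> pP nPF; apply: (big_ind (fun x => x \notin P)) => //.
  exact: prime_ideal1.
by move=> x y nPx nPy; apply: contraNN nPy => /prime_idealM; apply.
Qed.

End PrimeIdeals.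

(** * Independence of power products along a chain of primes *)

Section PowerProducts.
Local Open Scope ring_scope.

(** Nested pairs let recursion on [n] strip the exponent of [f 0]. *)
Fixpoint exponents (N n : nat) : finType :=
  if n is n'.+1 then ('I_N * exponents N n')%type else unit.

Lemma card_exponents N n : #|exponents N n| = (N ^ n)%N.
Proof.
by elim: n => [|n IHn] /=; rewrite ?card_unit // card_prod card_ord IHn expnS.
Qed.

Fixpoint power_product (R : comNzRingType) (N n : nat) (f : nat -> R) :
  exponents N n -> R :=
  if n is n'.+1
  then fun e => f 0%N ^+ e.1 * power_product (fun i => f i.+1) e.2
  else fun=> 1.

(* The coefficients vanish in lexicographic order: dividing the relation by the
   lowest power of [f 0] that occurs, and then killing [f 0], moves it from
   [Q 0] to [Q 1]. *)
Lemma chain_power_products_free (K : fieldType) (A : comAlgType K) (N n : nat)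
    (Q : nat -> {pred A}) (f : nat -> A) (c : exponents N n -> K) :
  (forall i, (i <= n)%N -> prime_ideal (Q i)) ->
  (forall i, (i < n)%N -> {subset Q i <= Q i.+1}) ->
  (forall i, (i < n)%N -> (f i \in Q i.+1) && (f i \notin Q i)) ->
  \sum_e c e *: power_product f e \in Q 0%N ->
  forall e, c e = 0.
Proof.
elim: n Q f c => [|n IHn] Q f c pQ subQ fQ Qsum.
  case; move: Qsum; rewrite (big_pred1 tt); last by case.
  move=> Qc; apply/eqP; move: Qc; apply: contraTT => nz_c.
  apply: contraNN (prime_ideal1 (pQ 0%N isT)) => Qc.
  rewrite -[1](scalerK nz_c) -mulr_algl.
  exact: prime_idealMl (pQ 0%N isT) Qc.
have [f01 f00] := andP (fQ 0%N isT); have pQ0 := pQ 0%N isT; have pQ1 := pQ 1%N isT.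
pose g (j : 'I_N) := \sum_e c (j, e) *: power_product (fun i => f i.+1) e.
have Dsum : \sum_e c e *: power_product f e = \sum_(j < N) f 0%N ^+ j * g j.
  transitivity (\sum_(j < N) \sum_(e : exponents N n)
      c (j, e) *: power_product f ((j, e) : exponents N n.+1)).
    by rewrite pair_big; apply: eq_bigr => -[].
  apply: eq_bigr => j _; rewrite mulr_sumr; apply: eq_bigr => e _.
  by rewrite -scalerAr.
suff c0 k (j : 'I_N) : (j < k)%N -> forall e, c (j, e) = 0.
  by case=> j e; apply: (c0 j.+1).
elim: k j => // k IHk j; rewrite ltnS leq_eqVlt => /predU1P[Ejk|]; last exact: IHk.
apply: (IHn (fun i => Q i.+1) (fun i => f i.+1) (fun e => c (j, e))) => [i|i|i|].
- exact: (pQ i.+1).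
- exact: (subQ i.+1).
- exact: (fQ i.+1).
rewrite -/(g j).
(* Terms with [i < j] vanish by [IHk], so the truncated [i - j.+1] is harmless there; those with
   [i > j] keep a factor [f 0]. *)
pose h := \sum_(i < N | i != j) f 0%N ^+ (i - j.+1) * g i.
suff : f 0%N ^+ j * (g j + f 0%N * h) \in Q 0%N.
  move=> /(prime_idealM pQ0)/(_ (prime_idealX j pQ0 f00))/(subQ 0%N isT).
  by apply: prime_idealDr => //; apply: prime_idealMr.
suff -> : f 0%N ^+ j * (g j + f 0%N * h) = \sum_(j < N) f 0%N ^+ j * g j.
  by rewrite -Dsum.
rewrite (bigD1 j) //= mulrDr; congr (_ + _).
rewrite mulrA -exprSr mulr_sumr; apply: eq_bigr => i nij.
have [ltij|leji] := ltnP i j.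
  rewrite [g i]big1 ?mulr0 // => e _.
  by rewrite IHk ?scale0r // -Ejk.
rewrite mulrA -exprD subnKC // ltn_neqAle leji andbT.
by apply: contraNneq nij => Eji; apply/eqP/val_inj.
Qed.

End PowerProducts.

(** * Dependence of more polynomials than variables, and lengths of prime chains *)

Section AlgebraicDependence.
Local Open Scope ring_scope.

Variables (K : fieldType) (n : nat).
Implicit Types p q : {mpoly K[n]}.

(** Bounding each exponent separately, not the degree, makes the monomials easy to count. *)
Definition exponents_le (b : nat) p :=
  forall m, m \in msupp p -> forall i, (m i <= b)%N.

Lemma leq_exp_base a b k : (a <= b)%N -> (a ^ k <= b ^ k)%N.
Proof. by case: k => // k leab; rewrite leq_exp2r. Qed.

Lemma exponents_le_msize p : exponents_le (msize p) p.
Proof.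
move=> m /msize_mdeg_lt/ltnW ltm i; apply: leq_trans ltm.
by rewrite mdegE (bigD1 i) //= leq_addr.
Qed.

Lemma exponents_leW b b' p :
  (b <= b')%N -> exponents_le b p -> exponents_le b' p.
Proof. by move=> leb ep m pm i; apply: leq_trans leb; apply: ep. Qed.

Lemma exponents_le1 b : exponents_le b 1.
Proof. by move=> m; rewrite msupp1 inE => /eqP-> i; rewrite mnm0E. Qed.

Lemma exponents_leM b b' p q :
  exponents_le b p -> exponents_le b' q -> exponents_le (b + b') (p * q).
Proof.
move=> ep eq m /msuppM_le/allpairsP[[m1 m2] /= [pm1 qm2 ->]] i.
by rewrite mnmDE leq_add ?ep ?eq.
Qed.

Lemma exponents_leX b p k : exponents_le b p -> exponents_le (k * b) (p ^+ k).
Proof.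
move=> ep; elim: k => [|k IHk]; first exact: exponents_le1.
by rewrite exprS mulSn; apply: exponents_leM.
Qed.

Lemma exponents_le_power_product b N k (f : nat -> {mpoly K[n]})
    (e : exponents N k) :
  (forall i, (i < k)%N -> exponents_le b (f i)) ->
  exponents_le (k * (N * b)) (power_product f e).
Proof.
elim: k f e => [|k IHk] f e fb; first exact: exponents_le1.
rewrite mulSn; apply: exponents_leM.
  apply: (@exponents_leW (e.1 * b)); last by apply: exponents_leX; apply: fb.
  by rewrite leq_mul2r ltnW ?orbT.
by apply: IHk => i lti; apply: (fb i.+1).
Qed.

(** There are [N ^ n.+1] power products, but the number of monomials they involve grows only like
    [N ^ n]. *)
Lemma power_products_dependent (f : nat -> {mpoly K[n]}) :
  exists N (c : exponents N n.+1 -> K),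
    \sum_e c e *: power_product f e = 0 /\ exists e, c e != 0.
Proof.
pose d := \max_(i < n.+1) msize (f i).
have fd i : (i < n.+1)%N -> exponents_le d (f i).
  move=> lti; apply: exponents_leW (@exponents_le_msize (f i)).
  exact: (leq_bigmax (Ordinal lti)).
(* [B <= N * (n.+1 * d).+1], and the [n]-th power of the last factor is below [N]; hence
   [B ^ n < N ^ n.+1]. *)
pose N := ((n.+1 * d).+1 ^ n).+1; pose B := (n.+1 * (N * d)).+1.
pose T := {ffun 'I_n -> 'I_B}.
pose mon (t : T) := [multinom (t i : nat) | i < n].
pose M := \matrix_(i < #|exponents N n.+1|, j < #|T|)
  (power_product f (enum_val i))@_(mon (enum_val j)).
have cardlt : (#|T| < #|exponents N n.+1|)%N.
  rewrite card_exponents card_ffun !card_ord expnS.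
  apply: (@leq_ltn_trans ((N * (n.+1 * d).+1) ^ n)).
    apply: leq_exp_base; rewrite /B mulnCA mulnS addnC -addn1 leq_add2l.
    exact: ltn0Sn.
  by rewrite expnMn mulnC ltn_mul2r expn_gt0 /= ltnSn.
have : kermx M != 0.
  rewrite kermx_eq0 /row_free; apply: contraTneq cardlt => <-.
  by rewrite -leqNgt rank_leq_col.
case/rowV0Pn=> v /sub_kermxP vM /rV0Pn[i nz_vi].
exists N, (fun e => v 0 (enum_rank e)); split; last first.
  by exists (enum_val i); rewrite enum_valK.
apply/mpolyP=> m; rewrite mcoeff0 raddf_sum.
(* Monomials with exponents below [B] are columns of [M]; all others occur in no power product. *)
have [/forallP mB|] := boolP [forall i, m i < B]%N.
  pose t : T := [ffun i => Ordinal (mB i)].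
  have Dm : mon t = m by apply/mnmP=> j; rewrite mnmE ffunE.
  transitivity ((v *m M) 0 (enum_rank t)); last by rewrite vM mxE.
  rewrite mxE.
  rewrite (reindex enum_rank) /=; last by apply: onW_bij; apply: enum_rank_bij.
  by apply: eq_bigr => e _; rewrite mxE !enum_rankK Dm; apply: mcoeffZ.
rewrite negb_forall => /existsP[j]; rewrite -leqNgt => Bmj.
rewrite big1 // => e _; rewrite [LHS]mcoeffZ memN_msupp_eq0 ?mulr0 //.
apply: contraTN Bmj => em; rewrite -ltnNge ltnS.
exact: exponents_le_power_product fd _ em j.
Qed.

Lemma prime_chain_le (Q : nat -> {pred {mpoly K[n]}}) (h : nat) :
  (forall i, (i <= h)%N -> prime_ideal (Q i)) ->
  (forall i, (i < h)%N -> {subset Q i <= Q i.+1} /\ ~ {subset Q i.+1 <= Q i}) ->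
  (h <= n)%N.
Proof.
move=> pQ ltQ; rewrite leqNgt; apply/negP=> ltnh.
(* Strictness only refutes an inclusion, so the choice of [f] exists up to double negation; this
   suffices for a contradiction. *)
have nofQ k : (k <= n.+1)%N ->
    ~ ~ exists f : nat -> {mpoly K[n]},
          forall i, (i < k)%N -> (f i \in Q i.+1) && (f i \notin Q i).
  elim: k => [|k IHk] lek; first by apply; exists (fun=> 0).
  move=> nf; apply: (IHk (ltnW lek)) => -[f fQ].
  have [_] := ltQ k (leq_trans lek ltnh); apply=> p Qp.
  apply: contraT => nQp; case: nf; exists (fun i => if i == k then p else f i) => i.
  by rewrite ltnS leq_eqVlt; case: eqP => [->|_ /fQ]; rewrite ?Qp.
apply: (nofQ n.+1) => // -[f fQ].
have [N [c [c0 [e /eqP[]]]]] := power_products_dependent f.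
apply: (chain_power_products_free (Q := Q) (f := f)) e => [i lei|i lti|i|].
- by apply: pQ; apply: leq_trans ltnh.
- by have [] := ltQ i (leq_trans lti ltnh).
- exact: fQ.
- by rewrite c0; apply: prime_ideal0; apply: pQ.
Qed.

End AlgebraicDependence.

(** * Monomial ideals and primes generated by variables *)

Section MonomialIdeals.
Local Open Scope ring_scope.

Variables (K : fieldType) (n : nat).
Implicit Types (U : pred 'X_{1..n}) (m : 'X_{1..n}) (p q f g h : {mpoly K[n]}).
Implicit Types (C : {set 'I_n}).

Definition monomial_ideal U : {pred {mpoly K[n]}} := [pred p | all U (msupp p)].

Definition upward_closed U := forall m m', U m -> U (m' + m)%MM.

Lemma monomial_idealP U p :
  reflect (forall m, m \in msupp p -> U m) (p \in monomial_ideal U).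
Proof. exact: allP. Qed.

Lemma monomial_ideal0 U : 0 \in monomial_ideal U.
Proof. by apply/monomial_idealP=> m; rewrite msupp0. Qed.

Lemma monomial_idealD U p q :
  p \in monomial_ideal U -> q \in monomial_ideal U -> p + q \in monomial_ideal U.
Proof.
move=> /monomial_idealP Up /monomial_idealP Uq; apply/monomial_idealP=> m.
by move/msuppD_le; rewrite mem_cat => /orP[/Up|/Uq].
Qed.

Lemma monomial_idealM U p q :
  upward_closed U -> q \in monomial_ideal U -> p * q \in monomial_ideal U.
Proof.
move=> upU /monomial_idealP Uq; apply/monomial_idealP=> m.
by case/msuppM_le/allpairsP=> -[m1 m2] /= [_ /Uq/upU Um ->]; apply: Um.
Qed.

Lemma monomial_idealX U m : ('X_[m] \in monomial_ideal U) = U m.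
Proof. by rewrite inE msuppX /= andbT. Qed.

Lemma monomial_idealMX U p m :
  (p * 'X_[m] \in monomial_ideal U) =
  (p \in monomial_ideal (fun m' => U (m + m')%MM)).
Proof. by rewrite !inE (perm_all _ (msuppMX p m)) all_map; apply: eq_all. Qed.

Definition restrict U p := \sum_(m <- msupp p | U m) p@_m *: 'X_[m].

Lemma mcoeff_restrict U p m : (restrict U p)@_m = if U m then p@_m else 0.
Proof.
rewrite raddf_sum /= big_mkcond /=.
under eq_bigr => m' _ do rewrite mcoeffZ mcoeffX.
have [pm|npm] := boolP (m \in msupp p).
  rewrite (bigD1_seq m) ?msupp_uniq //= eqxx mulr1 big1 ?addr0 // => m' /negbTE->.
  by rewrite mulr0 if_same.
rewrite (memN_msupp_eq0 npm) if_same big1_seq // => m' /= /(memPn npm)/negbTE->.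
by rewrite mulr0 if_same.
Qed.

Lemma msupp_restrict U p m : (m \in msupp (restrict U p)) = U m && (m \in msupp p).
Proof. by rewrite !mcoeff_msupp mcoeff_restrict; case: (U m); rewrite ?eqxx. Qed.

Lemma restrictB U p : p - restrict (predC U) p \in monomial_ideal U.
Proof.
apply/monomial_idealP=> m; rewrite mcoeff_msupp mcoeffB mcoeff_restrict /=.
by case: (U m) => //=; rewrite subrr eqxx.
Qed.

(** Deleting from [f] its monomials in [U] leaves a nonzero [f'] with [h * f'] still in the ideal.
    By [hU] no monomial of [h * f'] can satisfy [U], so this product is 0. *)
Lemma monomial_ideal_cancel U h f :
  (forall m m', m \in msupp h -> U (m + m')%MM -> U m') -> upward_closed U ->
  h * f \in monomial_ideal U -> f \notin monomial_ideal U -> h = 0.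
Proof.
move=> hU upU Uhf nUf; set f' := restrict (predC U) f.
have Uf' : f - f' \in monomial_ideal U by apply: restrictB.
have nz_f' : f' != 0 by apply: contraNneq nUf => f'0; rewrite -[f]subr0 -f'0.
apply/eqP; have : h * f' == 0.
  rewrite -msupp_eq0; case Es: (msupp (h * f')) => [|m s] //.
  have hfm : m \in msupp (h * f') by rewrite Es mem_head.
  have Um : U m.
    suff /monomial_idealP/(_ m hfm) : h * f' \in monomial_ideal U by [].
    have -> : h * f' = h * f + (- h) * (f - f').
      by rewrite mulrBr !mulNr opprK addrA subrr add0r.
    by apply: monomial_idealD => //; apply: monomial_idealM.
  case/msuppM_le/allpairsP: hfm Um => -[m1 m2] /= [hm1].
  rewrite msupp_restrict /= => /andP[nUm2 _] -> /(hU _ _ hm1).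
  by rewrite (negbTE nUm2).
by rewrite mulf_eq0 (negbTE nz_f') orbF.
Qed.

Definition meets C m := [exists i in C, 0 < m i]%N.

Lemma meets_up C : upward_closed (meets C).
Proof.
move=> m m' /exists_inP[i Ci mi]; apply/exists_inP; exists i => //.
by rewrite mnmDE ltn_addl.
Qed.

Definition var_prime C := monomial_ideal (meets C).

Lemma var_primeX C i : ('X_i \in var_prime C) = (i \in C).
Proof.
rewrite monomial_idealX; apply/exists_inP/idP => [[j Cj]|Ci].
  by rewrite mnm1E; case: eqP => // ->.
by exists i; rewrite // mnm1E eqxx.
Qed.

Lemma var_prime_sub P C :
  prime_ideal P -> (forall i, i \in C -> 'X_i \in P) -> {subset var_prime C <= P}.
Proof.
move=> pP XP p /monomial_idealP Cp; rewrite (mpolyE p) big_seq.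
apply: (big_ind (fun q => q \in P)) => [|q r|m /Cp/exists_inP[i Ci mi]].
- exact: prime_ideal0.
- exact: prime_idealD.
have -> : m = (m - U_(i) + U_(i))%MM.
  by rewrite submK //; apply/mnm_lepP=> j; rewrite mnm1E; case: eqP => // <-.
rewrite -mul_mpolyC mpolyXD mulrA; apply: prime_idealMl => //; exact: XP.
Qed.

Lemma restrict_meets C p :
  restrict (predC (meets C)) p = p \mPo [tuple if i \in C then 0 else 'X_i | i < n].
Proof.
rewrite comp_mpolyEX /restrict big_mkcond /=; apply: eq_bigr => m _.
rewrite comp_mpolyX; have [/exists_inP[i Ci mi]|nCm] := boolP (meets C m).
  by rewrite (bigD1 i) //= tnth_mktuple Ci expr0n eqn0Ngt mi mul0r scaler0.
congr (_ *: _); rewrite mpolyXE_id; apply: eq_bigr => i _; rewrite tnth_mktuple.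
case: ifP => // Ci; have := exists_inPn nCm i Ci.
by rewrite -leqNgt leqn0 => /eqP->.
Qed.

(** The ideal is the kernel of a substitution morphism into a domain, hence prime. *)
Lemma var_primeE C p :
  (p \in var_prime C) = (p \mPo [tuple if i \in C then 0 else 'X_i | i < n] == 0).
Proof.
rewrite -restrict_meets -msupp_eq0; apply/monomial_idealP/eqP => [Cp|r0 m pm].
  case Es: (msupp _) => [|m s] //; have := mem_head m s; rewrite -Es.
  by rewrite msupp_restrict /= => /andP[/negbTE nCm /Cp]; rewrite nCm.
have := msupp_restrict (predC (meets C)) p m.
by rewrite r0 pm andbT /=; case: meets.
Qed.

Lemma var_prime_prime C : prime_ideal (var_prime C).
Proof.
split=> [|p q].
  split=> [||a p q Cp Cq].
  - exact: monomial_ideal0.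
  - by rewrite var_primeE comp_mpoly1 oner_eq0.
  - by apply: monomial_idealD => //; apply: monomial_idealM => //; apply: meets_up.
by rewrite !var_primeE rmorphM mulf_eq0.
Qed.

End MonomialIdeals.

Arguments monomial_ideal K {n} U _.
Arguments var_prime K {n} C _.

(** * Heights of primes generated by variables *)

Section Heights.
Local Open Scope ring_scope.

Lemma has_prime_chain_eqi (R : comNzRingType) (P Q : {pred R}) k :
  P =i Q -> has_prime_chain P k -> has_prime_chain Q k.
Proof.
by move=> eqPQ [S [pS ltS eqS]]; exists S; split=> // x; rewrite eqS eqPQ.
Qed.

Lemma has_height_eqi (R : comNzRingType) (P Q : {pred R}) k :
  P =i Q -> has_height P k -> has_height Q k.
Proof.
move=> eqPQ [cP maxP]; split; first exact: has_prime_chain_eqi cP.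
by move=> j /(has_prime_chain_eqi (fun x => esym (eqPQ x)))/maxP.
Qed.

Lemma has_height_inj (R : comNzRingType) (P : {pred R}) h k :
  has_height P h -> has_height P k -> h = k.
Proof. by move=> [ch maxh] [ck maxk]; apply/eqP; rewrite eqn_leq maxh ?maxk. Qed.

Variables (K : fieldType) (n : nat).
Implicit Types C : {set 'I_n}.

(** Listing [C] first makes the flag pass through [var_prime K C] at index [#|C|]. *)
Let flag_vars C := enum C ++ enum (~: C).
Let flag C (i : nat) : {pred {mpoly K[n]}} :=
  var_prime K [set x in take i (flag_vars C)].

Let size_flag_vars C : size (flag_vars C) = n.
Proof. by rewrite size_cat -!cardE cardsC card_ord. Qed.

Let flag_lt C i : (i < n)%N ->
  {subset flag C i <= flag C i.+1} /\ ~ {subset flag C i.+1 <= flag C i}.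
Proof.
move=> lti; have lti' : (i < size (flag_vars C))%N by rewrite size_flag_vars.
pose x := nth (Ordinal lti) (flag_vars C) i.
have take_i : take i.+1 (flag_vars C) = rcons (take i (flag_vars C)) x.
  exact: take_nth.
split=> [|sub].
  apply: var_prime_sub => [|y]; first exact: var_prime_prime.
  by rewrite inE var_primeX inE take_i mem_rcons inE => ->; rewrite orbT.
have /sub : 'X_x \in flag C i.+1.
  by rewrite var_primeX inE take_i mem_rcons mem_head.
rewrite var_primeX inE; apply/negP.
have : uniq (take i.+1 (flag_vars C)).
  apply: take_uniq; rewrite cat_uniq !enum_uniq andbT; apply/hasPn=> y.
  by rewrite !mem_enum inE.
by rewrite take_i rcons_uniq => /andP[].
Qed.

Let flag_card C : flag C #|C| = var_prime K C.
Proof.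
rewrite /flag cardE take_size_cat //; congr var_prime.
by apply/setP=> x; rewrite inE mem_enum.
Qed.

(* Above any chain of primes ending at [var_prime C] one can add the remaining
   [n - #|C|] variables one by one. *)
Lemma var_prime_height C : has_height (var_prime K C) #|C|.
Proof.
have leCn : (#|C| <= n)%N by rewrite -[n in (_ <= n)%N]card_ord max_card.
split=> [|h [Q [pQ ltQ eqQ]]].
  exists (flag C); split=> [i _|i lti|x]; last by rewrite flag_card.
    exact: var_prime_prime.
  by apply: flag_lt; apply: leq_trans leCn.
(* The flag takes over at [i = h], where [flag C #|C|] agrees with [Q h]. *)
pose Q' i := if (i < h)%N then Q i else flag C (#|C| + (i - h)).
suff : (h + (n - #|C|) <= n)%N by lia.
apply: (@prime_chain_le _ _ Q') => i; rewrite /Q'.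
  by case: (ltnP i h) => [/ltnW/pQ //|_ _]; apply: var_prime_prime.
case: (ltnP i h) => [ltih _|lehi lti]; last first.
  rewrite ltnNge (leqW lehi) /= subSn // addnS; apply: flag_lt.
  by move: leCn lehi lti; clear; move: #|C| => c; lia.
case: (ltnP i.+1 h) => [_|lehi']; first exact: ltQ.
have [sub nsub] := ltQ i ltih; have Eh : i.+1 = h by lia.
rewrite Eh subnn addn0 flag_card; split=> [x Qx|sub'].
  by rewrite -eqQ -Eh sub.
by apply: nsub => x; rewrite Eh eqQ; apply: sub'.
Qed.

End Heights.

(** * Ideals generated by a finite family *)

Section GeneratedIdeals.
Local Open Scope ring_scope.
Variables (R : comNzRingType) (I : finType) (A : pred I) (F : I -> R).

Lemma generated_ideal0 : generated_ideal A F 0.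
Proof. by exists (fun=> 0); rewrite big1 // => i _; rewrite mul0r. Qed.

Lemma generated_idealD x y :
  generated_ideal A F x -> generated_ideal A F y -> generated_ideal A F (x + y).
Proof.
move=> [c ->] [d ->]; exists (fun i => c i + d i).
by rewrite -big_split; apply: eq_bigr => i _; rewrite mulrDl.
Qed.

Lemma mem_generated_ideal a i : A i -> generated_ideal A F (a * F i).
Proof.
move=> Ai; exists (fun j => if j == i then a else 0).
rewrite (bigD1 i) //= eqxx big1 ?addr0 // => j /andP[_ /negbTE->].
by rewrite mul0r.
Qed.

End GeneratedIdeals.

(** * The edge ideal as a monomial ideal, and its associated primes *)

Section EdgeIdeal.
Local Open Scope ring_scope.
Variables (K : fieldType) (V : finType) (D : wograph V).
Implicit Types (C S : {set V}) (x y z : V) (m : 'X_{1..#|V|}).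
Implicit Types (p q f g : {mpoly K[#|V|]}).
Local Notation arc := Defs.arc.
Let G := underlying D.
Let rk := @enum_rank V.

Definition edge_divides m :=
  [exists e : V * V,
     [&& arc D e.1 e.2, 0 < m (rk e.1) & weight D e.2 <= m (rk e.2)]]%N.

Lemma edge_dividesP m :
  reflect (exists x y, [/\ arc D x y, 0 < m (rk x) & weight D y <= m (rk y)])%N
          (edge_divides m).
Proof.
apply: (iffP existsP) => [[[x y] /and3P[]]|[x [y [Dxy mx my]]]].
  by exists x, y.
by exists (x, y); apply/and3P.
Qed.

Lemma edge_divides_up : upward_closed edge_divides.
Proof.
move=> m m' /edge_dividesP[x [y [Dxy mx my]]]; apply/edge_dividesP; exists x, y.
by rewrite !mnmDE ltn_addl // (leq_trans my) // leq_addl.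
Qed.

Lemma edge_idealP p : edge_ideal K D p <-> p \in monomial_ideal K edge_divides.
Proof.
have gen x y : vertex_var K x * vertex_var K y ^+ weight D y =
    'X_[(U_(rk x) + U_(rk y) *+ weight D y)].
  by rewrite /vertex_var mpolyXD -mpolyXn.
split=> [[c ->]|/monomial_idealP Ep].
  apply: (big_ind (fun q => q \in monomial_ideal K edge_divides)).
  - exact: monomial_ideal0.
  - by move=> q r; apply: monomial_idealD.
  case=> x y /= Dxy; apply: monomial_idealM; first exact: edge_divides_up.
  rewrite gen monomial_idealX; apply/edge_dividesP; exists x, y.
  by rewrite !mnmDE !mulmnE !mnm1E !eqxx Dxy; split=> //; lia.
rewrite (mpolyE p) big_seq.
apply: (big_ind (edge_ideal K D)) => [|q r|m /Ep/edge_dividesP[x [y [Dxy mx my]]]].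
- exact: generated_ideal0.
- exact: generated_idealD.
have nxy := arc_neq Dxy.
have -> : m = (m - (U_(rk x) + U_(rk y) *+ weight D y) +
               (U_(rk x) + U_(rk y) *+ weight D y))%MM.
  rewrite submK //; apply/mnm_lepP=> j; rewrite mnmDE mulmnE !mnm1E.
  case: eqP => [<-|_]; last by case: eqP => [<-|_]; rewrite ?mul1n ?mul0n.
  by rewrite (inj_eq enum_rank_inj) eq_sym (negbTE nxy) mul0n addn0.
rewrite mpolyXD -gen -mul_mpolyC mulrA.
exact: (@mem_generated_ideal _ _ (fun e : V * V => arc D e.1 e.2)
  (fun e => vertex_var K e.1 * vertex_var K e.2 ^+ weight D e.2) _ (x, y)).
Qed.

Lemma meets_rankP C m :
  reflect (exists2 x, x \in C & 0 < m (rk x))%N (meets (rk @: C) m).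
Proof.
apply: (iffP exists_inP) => [[_ /imsetP[x Cx ->] mx]|[x Cx mx]]; first by exists x.
by exists (rk x); rewrite ?imset_f.
Qed.

(** The prime is the colon ideal of a monomial that lies outside the edge ideal but enters it when
    multiplied by any variable of [C]. *)
Lemma strong_cover_associated C :
  strong_cover D C -> associated_prime (edge_ideal K D) (var_prime K (rk @: C)).
Proof.
case=> /vertex_coverP covC strC; split; first exact: var_prime_prime.
pose L1 x := [exists z, (z \notin C) && arc D x z].
(* Outside [C] the full weight is allowed. A vertex of [C] with an out-neighbour outside [C] gets 0,
   as one factor would complete an edge monomial; the others stop one short of their weight. *)
pose w x :=
  if x \notin C then weight D x else if L1 x then 0%N else (weight D x).-1.
pose m := [multinom w (enum_val i) | i < #|V|].
have mE x : m (rk x) = w x by rewrite mnmE enum_rankK.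
exists 'X_[m] => g; split=> [/monomial_idealP Cg|/edge_idealP].
  apply/edge_idealP; rewrite monomial_idealMX; apply/monomial_idealP=> m'.
  case/Cg/meets_rankP=> y Cy m'y; apply/edge_dividesP.
  have [L1y|nL1y] := boolP (L1 y).
    case/existsP: (L1y) => z /andP[nCz Dyz]; exists y, z.
    by rewrite !mnmDE !mE ltn_addl // /w nCz leq_addr.
  have wy : (weight D y <= (m + m')%MM (rk y))%N.
    rewrite mnmDE mE /w Cy (negbTE nL1y) /=.
    by move: m'y; move: (m' _) (weight D y) => u v; lia.
  case: (strC y Cy) => [[z nCz]|[z [Dzy wz /subsetP subC]]].
    rewrite underlyingE => /orP[Dyz|Dzy].
      by case/existsP: nL1y; exists z; rewrite nCz.
    exists z, y; split=> //.
    by rewrite mnmDE mE /w nCz ltn_addr // weight_gt0.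
  exists z, y; split=> //; rewrite mnmDE mE /w.
  have nL1z : ~~ L1 z.
    apply/existsPn=> t; rewrite negb_and negbK; case: (boolP (arc D z t)) => Dzt.
      by rewrite subC // inE.
    by rewrite orbT.
  by rewrite (negbTE nL1z); case: (z \notin C); have := weight_gt0 D z; lia.
rewrite monomial_idealMX => /monomial_idealP Eg; apply/monomial_idealP=> m' /Eg.
case/edge_dividesP=> x [y [Dxy]]; rewrite !mnmDE !mE => mx my; apply/meets_rankP.
(* Some end of the arc lies in [C] with too small an exponent in [m], so [m'] contributes to it. *)
have [Cx|nCx] := boolP (x \in C).
  have [Cy|nCy] := boolP (y \in C); last first.
    exists x => //; move: mx; rewrite /w Cx /=.
    by have -> : L1 x by apply/existsP; exists y; rewrite nCy.
  exists y => //; move: my; rewrite /w Cy /=; have := weight_gt0 D y.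
  by case: ifP => _; lia.
have Cy : y \in C by apply: covC nCx; rewrite underlyingE Dxy.
exists y => //; move: my; rewrite /w Cy /=; have := weight_gt0 D y.
by case: ifP => _; lia.
Qed.

(* Membership of ['X_[m]] in the primary component of the edge ideal attached
   to the minimal vertex cover [~: S]. *)
Definition component_divides S m :=
  [exists x, (x \notin S) && if [exists z in S, arc D x z] then (0 < m (rk x))%N
                              else (weight D x <= m (rk x))%N].

Lemma component_dividesP S m :
  reflect (exists2 x, x \notin S &
             if [exists z in S, arc D x z] then 0 < m (rk x)
             else weight D x <= m (rk x))%N
          (component_divides S m).
Proof. exact: exists_inP. Qed.

Lemma component_divides_up S : upward_closed (component_divides S).
Proof.
move=> m m' /component_dividesP[x nSx mx]; apply/component_dividesP; exists x => //.
by rewrite mnmDE; case: ifP mx => _; lia.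
Qed.

(** The head [y] is a witness unless it lies in [S]; then the tail [x] is outside [S] with an
    out-neighbour in [S]. *)
Lemma edge_divides_component S m :
  stable G S -> edge_divides m -> component_divides S m.
Proof.
move/stableP=> stS /edge_dividesP[x [y [Dxy mx my]]]; apply/component_dividesP.
have [Sy|nSy] := boolP (y \in S); last first.
  by exists y => //; case: ifP => // _; apply: leq_trans my; apply: weight_gt0.
exists x; last by case: ifP => // /exists_inPn/(_ y Sy); rewrite Dxy.
apply: contraTN Dxy => Sx; have := stS _ _ Sx Sy.
by rewrite underlyingE negb_or => /andP[].
Qed.

(** The hypothesis says that the components intersect in the edge ideal. If [P] is the colon ideal
    of [f], some component omits [f] and has all its variables in [P]; cancelling [f] modulo it
    shows that [P] contains nothing more. *)
Lemma associated_prime_maxset (P : {pred {mpoly K[#|V|]}}) :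
  (forall m, (forall S, maxset (stable G) S -> component_divides S m) ->
     edge_divides m) ->
  associated_prime (edge_ideal K D) P ->
  exists2 S, maxset (stable G) S & P =i var_prime K (rk @: ~: S).
Proof.
move=> capI [pP [f Pf]].
pose q S := monomial_ideal K (component_divides S).
have capq g : (forall S, maxset (stable G) S -> g \in q S) -> edge_ideal K D g.
  move=> qg; apply/edge_idealP/monomial_idealP=> m gm; apply: capI => S maxS.
  by have /monomial_idealP/(_ m gm) := qg S maxS.
have qsub g S : maxset (stable G) S -> edge_ideal K D g -> g \in q S.
  move=> /maxsetp stS /edge_idealP/monomial_idealP Eg; apply/monomial_idealP=> m gm.
  by apply: edge_divides_component => //; apply: Eg.
have [S /and3P[maxS nqf /forall_inP PS]] : exists S : {set V},
    [&& maxset (stable G) S, f \notin q S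
      & [forall x in ~: S, vertex_var K x \in P]].
  apply/existsP; apply: contraT => /existsPn noS.
  (* Without such an [S], [g * f] lies in every component, which puts [g] in [P] against
     primality. *)
  pose g := \prod_(x | vertex_var K x \notin P) vertex_var K x ^+ weight D x.
  have : g \notin P.
    by apply: prime_ideal_prod => // x; apply: prime_idealX.
  case/negP; apply/Pf/capq=> S maxS; have := noS S; rewrite maxS /=.
  have [qf _|nqf /=] := boolP (f \in q S).
    by apply: monomial_idealM => //; apply: component_divides_up.
  rewrite negb_forall => /existsP[x]; rewrite negb_imply inE => /andP[nSx nPx].
  rewrite /g (bigD1 x) //= -mulrA mulrC; apply: monomial_idealM.
    exact: component_divides_up.
  rewrite /vertex_var mpolyXn monomial_idealX.
  apply/component_dividesP; exists x => //.
  by rewrite mulmnE mnm1E eqxx mul1n leqnn weight_gt0 if_same.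
have subCP : {subset var_prime K (rk @: ~: S) <= P}.
  by apply: var_prime_sub => // _ /imsetP[x Cx ->]; apply: PS.
exists S => // g; apply/idP/idP; last exact: subCP.
move=> Pg; set C := rk @: ~: S; pose h := restrict (predC (meets C)) g.
have CB : g - h \in var_prime K C by apply: restrictB.
have Ph : h \in P.
  apply: (@prime_idealDr _ _ h (g - h)) => //; first exact: subCP.
  by rewrite addrC subrK.
suff h0 : h = 0 by rewrite h0 subr0 in CB.
(* The component only reads exponents outside [S], and the monomials of [h] have none there. *)
apply: (@monomial_ideal_cancel _ _ (component_divides S) _ f) nqf.
- move=> m m'; rewrite msupp_restrict /= => /andP[nCm _].
  have m0 x : x \notin S -> m (rk x) = 0%N.
    move=> nSx; apply/eqP; rewrite -leqn0 leqNgt; apply: contraNN nCm => mx.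
    by apply/meets_rankP; exists x; rewrite // inE.
  case/component_dividesP=> x nSx mx; apply/component_dividesP; exists x => //.
  by rewrite mnmDE m0 in mx.
- exact: component_divides_up.
- by apply: qsub => //; apply/Pf.
Qed.

End EdgeIdeal.

Theorem corollary3p6 (K : fieldType) (V : finType) (D : wograph V)
    (D_no_isolated : no_isolated_vertex (underlying D))
    (weight_source : forall x : V, source D x -> weight D x = 1%N)
    (weight_sink : forall x : V, sink D x -> weight D x = 1%N)
    (G_konig : konig (underlying D)) :
  unmixed (edge_ideal K D) <->
  very_well_covered (underlying D) /\
  (forall (P : {set {set V}}) (a b b' : V),
     perfect_matching (underlying D) P -> [set b; b'] \in P ->
     b' \in out_nbhd D a -> (1 < weight D a)%N ->
     nbhd D b \subset out_nbhd D a).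
Proof.
have cardC (C : {set V}) : #|enum_rank @: C| = #|C|.
  by apply: card_imset; apply: enum_rank_inj.
split=> [unmixedI|[vwcG nbP]].
  apply: strong_covers_equicardinal => // C C' scC scC'.
  have assC := strong_cover_associated K scC.
  have assC' := strong_cover_associated K scC'.
  have hC' := unmixedI _ _ assC assC' _ (var_prime_height K _).
  by have := has_height_inj hC' (var_prime_height K _); rewrite !cardC.
(* By contraposition: a monomial outside the edge ideal is missed by some component. *)
have capI m :
    (forall S, maxset (stable (underlying D)) S -> component_divides D S m) ->
    edge_divides D m.
  move=> qm; apply: contraT => nEm.
  have [|S maxS Sm] := @maxset_stable_avoiding _ D (fun x => m (enum_rank x))
    D_no_isolated G_konig vwcG nbP.
    move=> x y Dxy mx; rewrite ltnNge; apply: contraNN nEm => my.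
    by apply/edge_dividesP; exists x, y.
  have /component_dividesP[x nSx] := qm S maxS; have [mx dx] := Sm x nSx.
  case: ifP => [/exists_inP[z Sz Dxz] /dx|_]; last by rewrite leqNgt mx.
  by move/disjointFl/(_ Sz); rewrite inE Dxz.
move=> P Q /(associated_prime_maxset capI)[S maxS eqP].
case/(associated_prime_maxset capI)=> T maxT eqQ h hP.
have cST : #|~: S| = #|~: T|.
  case: vwcG => wcG _ _; rewrite (cardsCs (~: S)) (cardsCs (~: T)) !setCK.
  by rewrite (wcG _ _ maxS maxT).
have := has_height_inj (has_height_eqi eqP hP) (var_prime_height K _).
rewrite cardC cST -cardC => ->.
by apply: has_height_eqi (var_prime_height K _) => g; rewrite eqQ.
Qed.
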